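(* Let $S_n$ be the symmetric group of degree $n$, let $\lambda=(\lambda_1,\lambda_2,\dots,\lambda_l)\vdash n$ be a partition of $n$ with $l\geq 3$ parts, and let $S_\lambda$ be the Young subgroup of $S_n$ corresponding to $\lambda$. Then there does not exist any conjugacy class $X$ of $S_n$ such that $rS_n=XS_\lambda$ for some positive integer $r$.
   Context: A partition of $n$ is a tuple $\lambda=(\lambda_1,\dots,\lambda_l)$ of positive integers with $\lambda_1\ge\lambda_2\ge\dots\ge\lambda_l$ and $\lambda_1+\dots+\lambda_l=n$; $l$ is its number of parts. The Young subgroup $S_\lambda=S_{\lambda_1}\times S_{\lambda_2}\times\dots\times S_{\lambda_l}\le S_n$ is the subgroup preserving each of the consecutive blocks of $\{1,\dots,n\}$ of sizes $\lambda_1,\dots,\lambda_l$. For a finite group $G$, subsets $A,B\subseteq G$ and a positive integer $r$, the notation $rG=AB$ (also written $A\cdot B=rG$) means that for every $g\in G$ there are exactly $r$ pairs $(a,b)\in A\times B$ with $ab=g$. *)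

(* Defs.v *)
From mathcomp Require Import all_boot all_fingroup.

Set Implicit Arguments.
Unset Strict Implicit.
Unset Printing Implicit Defensive.

Import GroupScope.

Definition is_partition_of (n : nat) (la : seq nat) : bool :=
  [&& sorted geq la, all (ltn 0) la & sumn la == n].

(* Points are numbered from 0, so the k-th block (also counted from 0) is
   { la_0 + ... + la_(k-1), ..., la_0 + ... + la_k - 1 }. *)
Definition young_block (n : nat) (la : seq nat) (k : nat) : {set 'I_n} :=
  [set i : 'I_n | (sumn (take k la) <= i < sumn (take k.+1 la))%N].

(* 'N(A | 'P) is the global (setwise) stabiliser of A under the natural
   action of permutations. *)
Definition young_subgroup (n : nat) (la : seq nat) : {set 'S_n} :=
  \bigcap_(k < size la) 'N(young_block n la k | 'P).

Canonical young_subgroup_group (n : nat) (la : seq nat) :=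
  Eval hnf in [group of young_subgroup n la].

(* rG = AB: every g in G is a product ab for exactly r pairs (a, b).
   MathComp permutations compose left to right: (s * t) x = t (s x). *)
Definition rfactorization (gT : finGroupType) (G : {group gT}) (r : nat)
    (A B : {set gT}) : Prop :=
  [/\ A \subset G, B \subset G &
      forall g, g \in G ->
        #|[set p : gT * gT | [&& p.1 \in A, p.2 \in B & p.1 * p.2 == g]]| = r].

(* Main.v *)
Require Import Defs.
From mathcomp Require Import all_boot all_fingroup.
From mathcomp Require Import zify.

Set Implicit Arguments.
Unset Strict Implicit.
Unset Printing Implicit Defensive.

Import GroupScope.

(** Call [X] the class and suppose that every left coset of the Young subgroup
[H] meets [X] in exactly [r] points.  Since [X] is closed under conjugation,
the number of [g] in [X] with a given right-[H]-invariant property does not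
change when [g] is multiplied by a fixed permutation
([rfactorization_class_card]).  The subgroup [H] enters through the fact that it
stabilises two disjoint nonempty sets [A] and [B] that do not cover all points;
the third part of the partition provides the uncovered point.

Taking the property that [g] sends [i] into [A], and exchanging a point of [A]
with a point outside [A], one finds that all points are equally likely as the
image of [i] under an element of [X] ([one_point_card]).  So the elements of
[X] have one fixed point on average, hence exactly one each, because they are
conjugate ([card_fix_eq1]).

Now fix [a] in [A] and [b] in [B], and let [v k l] count the [g] in [X] that
send [a] to [k] and [b] to [l].  The matrix [v] has constant row and column
sums [rho > 0], and [v a b = 0], since an element counted there would have two
fixed points.  Taking the property that [g] sends [a] into [A] and [b] into [B],
one finds that the sum of [v] over [yA * yB] is the same for all permutations
[y] ([two_point_sum]).  Exchanges of points again extract information about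
single entries.
- If [A] is a singleton, an exchange between [B] and the uncovered point shows
  that each row of [v] is constant off the diagonal, so row [a] vanishes.
- If [A] has a second point, two successive exchanges give
  [v i j + v k m = v i m + v k j] for distinct [i], [j], [k], [m]
  ([block_sum_cross]).  With the zero entry at [(a, b)] this makes the entries
  outside row [a] and column [b] too large for the row sums
  ([cross_matrix_sum0]).
Either way [rho = 0], a contradiction.

In representation-theoretic terms, the permutation module on ordered pairs of
distinct points embeds in the one on cosets of [H], so that the class sum of [X]
would act on pairs as a multiple of the all-ones matrix; the argument above
makes the part of this embedding that is needed explicit. *)

(** * Factorizations with a conjugacy class as a factor *)

Section Factorizations.

Variable gT : finGroupType.
Implicit Types (G : {group gT}) (A B X : {set gT}) (P : pred gT).

(** Both sides count the pairs [(a, b)] in [A * B] such that [P] holds at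
[a * b], which is the same as [P] holding at [a]. *)
Lemma rfactorization_card G r A B P :
    rfactorization G r A B ->
    (forall g h, g \in G -> h \in B -> P (g * h) = P g) ->
  (#|B| * #|[set a in A | P a]| = r * #|[set g in G | P g]|)%N.
Proof.
move=> [/subsetP sAG /subsetP sBG rAB] invP.
have -> : (r * #|[set g in G | P g]| =
    \sum_(g in [set g in G | P g])
      #|[set p : gT * gT | [&& p.1 \in A, p.2 \in B & (p.1 * p.2)%g == g]]|)%N.
  rewrite mulnC -sum_nat_const; apply: eq_bigr => g.
  by rewrite inE => /andP[/rAB].
under eq_bigr => g _ do rewrite -sum1_card.
rewrite mulnC -cardsX -sum1_card.
rewrite (partition_big (fun p : gT * gT => p.1 * p.2)
                       (mem [set g in G | P g])) /=; last first.
  move=> [a b]; rewrite !inE /= => /andP[/andP[Aa Pa] Bb].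
  by rewrite groupM ?(sAG _ Aa) ?(sBG _ Bb) //= invP ?sAG.
apply: eq_bigr => g; rewrite inE => /andP[Gg Pg]; apply: eq_bigl => -[a b].
rewrite !inE /=; case: eqP => [abg | _]; last by rewrite !andbF.
have [Aa | _] := boolP (a \in A) => //=.
have [Bb | _] := boolP (b \in B); last by rewrite !andbF.
by rewrite -(invP a b) ?sAG // abg Pg.
Qed.

(** Conjugation by [y] turns [a * y] into [y * a], and left multiplication
by [y] both preserves right [B]-invariance and permutes the whole group. *)
Lemma rfactorization_class_card r X B P y :
    rfactorization [set: gT]%G r X B -> X \in classes [set: gT] ->
    (0 < #|B|)%N ->
    (forall g h, h \in B -> P (g * h) = P g) ->
  #|[set a in X | P (a * y)]| = #|[set a in X | P a]|.
Proof.
move=> rXB clX B_gt0 invP.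
have XJ a : (a ^ y \in X) = (a \in X).
  have /imsetP[x _ ->] := clX.
  by rewrite class_sym classGidl ?inE // class_sym.
have -> : #|[set a in X | P (a * y)]| = #|[set a in X | P (y * a)]|.
  rewrite -(card_imset _ (conjg_inj y)); apply: eq_card => a.
  rewrite -[a](conjgKV y) (mem_imset _ _ (conjg_inj y)) !inE.
  by rewrite XJ -conjgC.
apply/eqP; rewrite -(eqn_pmul2l B_gt0).
have inv_yP g h : g \in [set: gT] -> h \in B -> P (y * (g * h)) = P (y * g).
  by move=> _ Bh; rewrite mulgA (invP _ h).
have inv_P g h : g \in [set: gT] -> h \in B -> P (g * h) = P g.
  by move=> _; apply: invP.
rewrite (rfactorization_card (P := fun a => P (y * a)) rXB inv_yP).
rewrite (rfactorization_card rXB inv_P).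
apply/eqP; congr (r * _)%N.
rewrite -(card_imset _ (mulgI y)); apply: eq_card => a.
by rewrite -[a](mulKVg y) (mem_imset _ _ (mulgI y)) !inE.
Qed.

End Factorizations.

(** * Extracting single entries from block sums *)

Lemma perm_extend (T : finType) (s t : seq T) :
  uniq s -> uniq t -> size s = size t -> exists y : {perm T}, map y s = t.
Proof.
elim: s t => [|x s IHs] [|z t] //=; first by exists 1.
move=> /andP[sx Us] /andP[tz Ut] [/(IHs _ Us Ut)[y yst]].
exists (y * tperm (y x) z); rewrite permM tpermL; congr (_ :: _).
rewrite -[RHS]map_id -[in RHS]yst -!map_comp; apply/eq_in_map => v sv /=.
rewrite permM tpermD //.
  by apply: contraNneq sx => /perm_inj->.
by apply: contraNneq tz => ->; rewrite -yst map_f.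
Qed.

Section Swaps.

Variable T : finType.

Lemma sum_tperm (A : {set T}) a c (F : T -> nat) :
    a \in A -> c \notin A ->
  (\sum_(i in A) F (tperm a c i) + F a = \sum_(i in A) F i + F c)%N.
Proof.
move=> Aa Ac; rewrite (bigD1 a) //= [in RHS](bigD1 a) //= tpermL.
rewrite [RHS]addnC -addnA; congr addn; rewrite addnC; congr addn.
apply: eq_bigr => i /andP[Ai ia]; rewrite tpermD 1?eq_sym //.
by apply: contraNneq Ac => <-.
Qed.

Lemma sum_tperm_out (B : {set T}) a c (F : T -> nat) :
    a \notin B -> c \notin B ->
  \sum_(j in B) F (tperm a c j) = \sum_(j in B) F j.
Proof.
move=> Ba Bc; apply: eq_bigr => j Bj; rewrite tpermD //.
  by apply: contraNneq Ba => ->.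
by apply: contraNneq Bc => ->.
Qed.

Variables (A B : {set T}) (a b c : T).
Hypotheses (disAB : [disjoint A & B]) (Aa : a \in A) (Bb : b \in B).
Hypotheses (Ac : c \notin A) (Bc : c \notin B).

Let Ba : a \notin B. Proof. by rewrite (disjointFr disAB). Qed.
Let Ab : b \notin A. Proof. by rewrite (disjointFl disAB). Qed.

(** Compare the block sums at [y] and at [tperm a c * y]: they differ only in the
row of [a], which is replaced by that of [c]. *)
Lemma block_sum_swapl (w : T -> T -> nat) c0 :
    (forall y : {perm T}, \sum_(i in A) \sum_(j in B) w (y i) (y j) = c0) ->
  forall y : {perm T},
    \sum_(j in B) w (y a) (y j) = \sum_(j in B) w (y c) (y j).
Proof.
move=> wc y; have := wc (tperm a c * y).
under eq_bigr => i _.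
  under eq_bigr => j _ do rewrite !permM.
  rewrite (sum_tperm_out (fun j => w (y (tperm a c i)) (y j)) Ba Bc).
  over.
have := sum_tperm (fun i => \sum_(j in B) w (y i) (y j)) Aa Ac.
rewrite wc /= => + e; rewrite e; exact: addnI.
Qed.

(** Apply the previous lemma at [y] and at [tperm b p * y]: exchanging the column
of [b] for that of [p] changes both sides by the same amount. *)
Lemma block_sum_cross (w : T -> T -> nat) c0 p :
    p \in A -> p != a ->
    (forall y : {perm T}, \sum_(i in A) \sum_(j in B) w (y i) (y j) = c0) ->
  forall i j k m, uniq [:: i; j; k; m] ->
  (w i j + w k m = w i m + w k j)%N.
Proof.
move=> Ap pa wc i j k m U.
have ab : a != b by apply: contraNneq Ab => <-.
have ac : a != c by apply: contraNneq Ac => <-.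
have bc : b != c by apply: contraNneq Bc => <-.
have pb : p != b by apply: contraNneq Ab => <-.
have pc : p != c by apply: contraNneq Ac => <-.
have Bp : p \notin B by rewrite (disjointFr disAB).
have [y [<- <- <- <-]] : exists y : {perm T},
    map y [:: a; b; c; p] = [:: i; j; k; m].
  apply: perm_extend => //=.
  by rewrite !inE !negb_or ab ac bc ![_ == p]eq_sym pa pb pc.
have e1 := block_sum_swapl wc y.
have := block_sum_swapl wc (tperm b p * y).
under eq_bigr => j' _ do rewrite !permM (tpermD _ pa) 1?eq_sym //.
under [RHS]eq_bigr => j' _ do rewrite !permM (tpermD bc pc).
have := sum_tperm (fun j' => w (y a) (y j')) Bb Bp.
have := sum_tperm (fun j' => w (y c) (y j')) Bb Bp.
rewrite /= e1 => ec ea e2; move: ec ea; rewrite e2 {e1 e2}.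
move: (\sum_(j in B) _) (\sum_(j in B) _) => S Z; clear; lia.
Qed.

End Swaps.

(** For [k] other than [s] and [t], the cross relation with [w s t = 0] reads
[w k m = w s m + w k t].  Summing over [m] and comparing rows [k] and [s] gives
[2 * w k t <= w s k]; summing this over [k] gives [2 * rho <= rho].  Only one
value of [m] is treated exactly, which is why the existence of a single fourth
point suffices; for the others [w s m <= w k m] is enough. *)
Lemma cross_matrix_sum0 (T : finType) (w : T -> T -> nat) (s t : T) rho :
    s != t -> w s t = 0 -> (forall k, w k k = 0) ->
    (forall k, \sum_l w k l = rho) -> (forall l, \sum_k w k l = rho) ->
    (forall k, k != s -> k != t -> exists m, uniq [:: s; t; k; m]) ->
    (forall i j k m, uniq [:: i; j; k; m] -> w i j + w k m = w i m + w k j)%N ->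
  rho = 0.
Proof.
move=> st wst wd row col fresh cross.
suff le2 k : (w k t + w k t <= w s k)%N.
  have : (\sum_k (w k t + w k t) <= \sum_k w s k)%N by apply: leq_sum.
  by rewrite big_split /= col row -[leqRHS]add0n leq_add2r leqn0 => /eqP.
have [-> | ks] := eqVneq k s; first by rewrite wst.
have [-> | kt] := eqVneq k t; first by rewrite wd.
have [m Um] := fresh k ks kt; have := cross _ _ _ _ Um.
move: Um; rewrite /= !inE !negb_or !andbT.
move=> /and3P[/and3P[_ sk sm] /andP[tk tm] km].
have mk : m != k by rewrite eq_sym.
have mt : m != t by rewrite eq_sym.
have := row k; have := row s.
rewrite (bigD1 t) // (bigD1 m) //= (bigD1 k) ?kt ?km //=.
rewrite [X in _ -> X = _ -> _](bigD1 t) // (bigD1 m) //=.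
rewrite [in X in _ -> X -> _](bigD1 k) ?kt ?km //=.
have : (\sum_(i | [&& i != t, i != m & i != k]) w s i <=
        \sum_(i | [&& i != t, i != m & i != k]) w k i)%N.
  apply: leq_sum => i /and3P[it im ik].
  have [-> | si] := eqVneq i s; first by rewrite wd.
  have := cross s t k i; rewrite /= !inE !negb_or !andbT wst.
  rewrite st sk tk ![_ == i]eq_sym si it ik => /(_ isT).
  by rewrite add0n => ->; apply: leq_addr.
under eq_bigl => i do rewrite andbA.
under [X in (_ <= X)%N]eq_bigl => i do rewrite andbA.
rewrite wst wd.
move: (\sum_(i | _) _) (\sum_(i | _) _) => S S'; clear; lia.
Qed.

(** * Images of points under the elements of the class *)

Lemma sum_fiber_card (gT rT : finType) (X : {set gT}) (D : {set rT})
    (P : pred gT) (f : gT -> rT) :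
  \sum_(k in D) #|[set a in X | P a && (f a == k)]| =
  #|[set a in X | P a && (f a \in D)]|.
Proof.
rewrite -sum1_card (partition_big f (mem D)) /=; last first.
  by move=> a; rewrite inE => /and3P[].
apply: eq_bigr => k Dk; rewrite -sum1_card; apply: eq_bigl => a.
rewrite !inE; case: eqP => [->|_]; last by rewrite !andbF.
by rewrite Dk !andbT.
Qed.

Lemma sum_fiber_cardT (gT rT : finType) (X : {set gT})
    (P : pred gT) (f : gT -> rT) :
  \sum_k #|[set a in X | P a && (f a == k)]| = #|[set a in X | P a]|.
Proof.
have := sum_fiber_card X setT P f; rewrite (eq_bigl xpredT) => [->|k].
  by apply: eq_card => a; rewrite !inE andbT.
by rewrite inE.
Qed.

Lemma card_fix_conj (T : finType) (a y : {perm T}) :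
  #|[set i | (a ^ y) i == i]| = #|[set i | a i == i]|.
Proof.
rewrite -[RHS](card_imset _ (@perm_inj _ y)); apply: eq_card => i.
rewrite -[i](permKV y) (mem_imset _ _ (@perm_inj _ y)) !inE.
by rewrite permJ (inj_eq perm_inj).
Qed.

Section NoClass.

Variables (T : finType) (X H : {set {perm T}}) (r : nat).
Variables (A B : {set T}) (a b c : T).
Hypotheses (clX : X \in classes [set: {perm T}]) (H_gt0 : (0 < #|H|)%N).
Hypothesis stabA : forall (h : {perm T}) i, h \in H -> (h i \in A) = (i \in A).
Hypothesis stabB : forall (h : {perm T}) i, h \in H -> (h i \in B) = (i \in B).
Hypotheses (disAB : [disjoint A & B]) (Aa : a \in A) (Bb : b \in B).
Hypotheses (Ac : c \notin A) (Bc : c \notin B).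
Hypothesis rXH : rfactorization [set: {perm T}]%G r X H.

Let X_gt0 : (0 < #|X|)%N.
Proof.
by have /imsetP[x _ ->] := clX; apply/card_gt0P; exists x; apply: class_refl.
Qed.

Let T_gt0 : (0 < #|T|)%N. Proof. by apply/card_gt0P; exists a. Qed.

Let ac : a != c. Proof. by apply: contraNneq Ac => <-. Qed.

Let ab : a != b.
Proof. by apply: contraTneq Aa => ->; rewrite (disjointFl disAB). Qed.

Let bc : b != c. Proof. by apply: contraNneq Bc => <-. Qed.

Let eq_permMV (y g : {perm T}) z k : ((g * y^-1) z == k) = (g z == y k).
Proof. by rewrite permM (canF_eq (permKV y)). Qed.

Lemma one_point_sum i (y : {perm T}) :
  \sum_(k in A) #|[set g in X | g i == y k]| = #|[set g in X | g i \in A]|.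
Proof.
rewrite -(rfactorization_class_card (P := fun g : {perm T} => g i \in A)
            y^-1 rXH clX) // => [|g h /stabA e]; last by rewrite permM e.
rewrite -(sum_fiber_card X A predT (fun g : {perm T} => (g * y^-1) i)).
by apply: eq_bigr => k _; apply: eq_card => g; rewrite !inE eq_permMV.
Qed.

Lemma one_point_const i k k' :
  #|[set g in X | g i == k]| = #|[set g in X | g i == k']|.
Proof.
have [<- // | kk'] := eqVneq k k'.
have [y [<- <-]] : exists y : {perm T}, map y [:: a; c] = [:: k; k'].
  by apply: perm_extend => //=; rewrite inE ?ac ?kk'.
have := sum_tperm (fun k => #|[set g in X | g i == y k]|) Aa Ac.
rewrite one_point_sum.
under eq_bigr => j _ do rewrite -permM.
by rewrite one_point_sum => /addnI.
Qed.

Lemma one_point_card i k : (#|T| * #|[set g in X | g i == k]| = #|X|)%N.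
Proof.
rewrite -sum_nat_const.
under eq_bigr => k' _ do rewrite (one_point_const i k k').
rewrite (sum_fiber_cardT X predT (fun g : {perm T} => g i)).
by apply: eq_card => g; rewrite inE andbT.
Qed.

(** The average number of fixed points is 1 by [one_point_card], and the number
is constant on the class. *)
Lemma card_fix_eq1 g : g \in X -> #|[set i | g i == i]| = 1%N.
Proof.
move=> Xg; apply/eqP; rewrite -(eqn_pmul2l X_gt0) muln1.
rewrite -sum_nat_const -(eqn_pmul2l T_gt0).
have -> : (\sum_(h in X) #|[set i | g i == i]| =
           \sum_i #|[set h in X | h i == i]|)%N.
  under [RHS]eq_bigr => i _ do rewrite -sum1dep_card big_mkcondr.
  rewrite exchange_big; apply: eq_bigr => h Xh.
  have /imsetP[x _ dX] := clX.
  move: Xg Xh; rewrite dX => /imsetP[y _ ->] /imsetP[z _ ->].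
  by rewrite !card_fix_conj -big_mkcond sum1dep_card card_fix_conj.
rewrite big_distrr /=.
under eq_bigr => i _ do rewrite one_point_card.
by rewrite sum_nat_const.
Qed.

Let v k l := #|[set g in X | (g a == k) && (g b == l)]|.

Lemma two_point_sum (y : {perm T}) :
  \sum_(k in A) \sum_(l in B) v (y k) (y l) =
    #|[set g in X | (g b \in B) && (g a \in A)]|.
Proof.
rewrite -(rfactorization_class_card
            (P := fun g : {perm T} => (g b \in B) && (g a \in A))
            y^-1 rXH clX) //
  => [|g h Hh]; last by rewrite !permM (stabA _ Hh) (stabB _ Hh).
pose f z (g : {perm T}) := (g * y^-1) z.
rewrite -(sum_fiber_card X A (fun g => f b g \in B) (f a)).
apply: eq_bigr => k _.
under eq_finset => g do rewrite [X in _ && X]andbC.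
rewrite -(sum_fiber_card X B (fun g => f a g == k) (f b)).
by apply: eq_bigr => l _; apply: eq_card => g; rewrite !inE !eq_permMV.
Qed.

(** By [card_fix_eq1] the entry [v a b] vanishes; in each of the two cases, [A]
with a second point or [A] a singleton, this spreads until [rho = 0]. *)
Lemma no_class_rfactorization : False.
Proof.
pose rho := #|[set g in X | g a == a]|.
have rho_u i k : #|[set g in X | g i == k]| = rho.
  by apply/eqP; rewrite -(eqn_pmul2l T_gt0) !one_point_card.
have rho_gt0 : (0 < rho)%N.
  by move: X_gt0; rewrite -(one_point_card a a) muln_gt0 => /andP[].
have vab : v a b = 0.
  apply/eqP; rewrite cards_eq0; apply/set0Pn => -[g].
  rewrite inE => /and3P[/card_fix_eq1 f1 ga gb].
  have: (#|[set a; b]| <= 1)%N.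
    rewrite -f1; apply: subset_leq_card; apply/subsetP => i.
    by rewrite !inE => /orP[] /eqP->.
  by rewrite cards2 ab.
have vd k : v k k = 0.
  apply/eqP; rewrite cards_eq0; apply/set0Pn => -[g].
  rewrite inE => /and3P[_ /eqP ga /eqP gb].
  by case/eqP: ab; apply: (@perm_inj _ g); rewrite ga gb.
have row k : \sum_l v k l = rho.
  by rewrite -(rho_u a k) -(sum_fiber_cardT X _ (fun g : {perm T} => g b)).
have col l : \sum_k v k l = rho.
  rewrite -(rho_u b l) -(sum_fiber_cardT X _ (fun g : {perm T} => g a)).
  by apply: eq_bigr => k _; apply: eq_card => g; rewrite !inE [X in _ && X]andbC.
have extend3 k : k != a -> k != b ->
    exists y : {perm T}, [/\ y a = a, y b = b & y c = k].
  move=> ka kb.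
  have [|||y [ya yb yc]] := @perm_extend T [:: a; b; c] [:: a; b; k].
  - by rewrite /= !inE !negb_or ab ac bc.
  - by rewrite /= !inE !negb_or ab ![_ == k]eq_sym ka kb.
  - by [].
  by exists y.
suff rho0 : rho = 0 by rewrite rho0 in rho_gt0.
have [p /andP[Ap pa] | A1] := pickP [pred p | (p \in A) && (p != a)].
  apply: (cross_matrix_sum0 ab vab vd row col).
    move=> k ka kb; have [y [ya yb yc]] := extend3 k ka kb; exists (y p).
    have pb : p != b by apply: contraTneq Ap => ->; rewrite (disjointFl disAB).
    have pc : p != c by apply: contraNneq Ac => <-.
    have -> : [:: a; b; k; y p] = map y [:: a; b; c; p] by rewrite /= ya yb yc.
    rewrite (map_inj_uniq (@perm_inj _ y)).
    by rewrite /= !inE !negb_or ab ac bc ![_ == p]eq_sym pa pb pc.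
  exact: (block_sum_cross disAB Aa Bb Ac Bc Ap pa two_point_sum).
have defA : A = [set a].
  apply/setP => i; rewrite inE; have := A1 i; rewrite /=.
  by case: eqP => [-> // | _]; rewrite andbT.
rewrite -(row a); apply: big1 => l _.
have [-> | la] := eqVneq l a; first exact: vd.
have [-> // | lb] := eqVneq l b.
have [y [ya yb yc]] := extend3 l la lb.
(* Exchanging points of [B] and its complement moves columns of [v], so the row
   lemma is applied to the transpose of [v]. *)
have disBA : [disjoint B & A] by rewrite disjoint_sym.
have vT_sum (z : {perm T}) : \sum_(j in B) \sum_(i in A) v (z i) (z j) =
    #|[set g in X | (g b \in B) && (g a \in A)]|.
  by rewrite exchange_big two_point_sum.
have := block_sum_swapl (w := fun j i => v i j) disBA Bb Bc Ac vT_sum y.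
by rewrite defA !big_set1 ya yb yc vab => <-.
Qed.

End NoClass.

(** * Young subgroups *)

Theorem theorem3p3 (n : nat) (la : seq nat) :
  is_partition_of n la -> (3 <= size la)%N ->
  ~ (exists (X : {set 'S_n}) (r : nat),
       [/\ X \in classes [set: 'S_n], (0 < r)%N &
           rfactorization [set: 'S_n]%G r X (young_subgroup n la)]).
Proof.
move=> /and3P[_ la_gt0 /eqP dn] la3 [X [r [clX _ rXH]]].
have stab k (h : 'S_n) i : (k < size la)%N -> h \in young_subgroup n la ->
    (h i \in young_block n la k) = (i \in young_block n la k).
  move=> ltk /bigcapP/(_ (Ordinal ltk) isT) Nh.
  exact: (astabs_act (to := 'P) i Nh).
case: la => [|x [|y [|z la]]] // in la_gt0 dn la3 rXH stab *.
move: la_gt0 dn => /= /and4P[x_gt0 y_gt0 z_gt0 _] dn.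
have lt_a : (0 < n)%N by lia.
have lt_b : (x < n)%N by lia.
have lt_c : (x + y < n)%N by lia.
(* [A] and [B] are the first two blocks; the points are the first elements of the
   first three blocks. *)
apply: (@no_class_rfactorization _ X (young_subgroup n [:: x, y, z & la]) r
          (young_block n [:: x, y, z & la] 0) (young_block n [:: x, y, z & la] 1)
          (Ordinal lt_a) (Ordinal lt_b) (Ordinal lt_c) clX).
- exact: cardG_gt0 (young_subgroup_group n [:: x, y, z & la]).
- by move=> h i; apply: stab.
- by move=> h i; apply: stab.
- rewrite disjoint_subset; apply/subsetP => i; rewrite !inE /= ?take0 /=; lia.
- by rewrite inE /= ?take0 /=; lia.
- by rewrite inE /= ?take0 /=; lia.
- by rewrite inE /= ?take0 /=; lia.
- by rewrite inE /= ?take0 /=; lia.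
- exact: rXH.
Qed.
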